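(* Let $p \ge \sqrt{3}$ be a real number, and let $u:\mathbb{R}\times\mathbb{R}\to\mathbb{R}$, $u=u(t,x)$, be a global Schwartz solution, not identically zero, of the defocusing generalized KdV equation $$\partial_t u + \partial_x^3 u = \partial_x\big(|u|^{p-1}u\big).$$ Then for any function $x:\mathbb{R}\to\mathbb{R}$, $t\mapsto x(t)$, $$\sup_{t\in\mathbb{R}} \int_{\mathbb{R}} (x-x(t))^2\, u^2(t,x)\,dx = \infty.$$
   Context: The solution $u$ is real-valued. A global Schwartz solution is a classical solution defined for all times $t\in\mathbb{R}$ such that $u(t,\cdot)$ belongs to the Schwartz class $\mathcal{S}(\mathbb{R})$ for every $t$, with $t\mapsto u(t,\cdot)$ continuously differentiable from $\mathbb{R}$ into $\mathcal{S}(\mathbb{R})$ and the equation holding for all $(t,x)\in\mathbb{R}\times\mathbb{R}$. In the integral, $x$ denotes the integration variable and $x(t)$ the value of the given function at time $t$; no regularity of $t\mapsto x(t)$ is assumed. *)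

(* Defs.v *)
From mathcomp Require Import all_boot all_order all_algebra.
From mathcomp Require Import all_classical all_reals all_analysis.
Set Implicit Arguments.
Unset Strict Implicit.
Unset Printing Implicit Defensive.
Import Order.TTheory GRing.Theory Num.Theory.
Import numFieldNormedType.Exports.
Local Open Scope classical_set_scope.
Local Open Scope ring_scope.

Definition smooth (R : realType) (f : R -> R) : Prop :=
  forall (n : nat) (x : R), derivable (derive1n n f) x 1.

(* [derive1n] is total, so this is meaningful only for smooth [f]. *)
Definition schwartz_seminorm (R : realType) (k n : nat) (f : R -> R) : \bar R :=
  ereal_sup (range (fun x : R => (`|x ^+ k * derive1n n f x|)%:E)).

Definition schwartz (R : realType) (f : R -> R) : Prop :=
  smooth f /\ forall k n : nat, (schwartz_seminorm k n f < +oo)%E.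

(* Convergence in the Frechet topology of the Schwartz space, which the
   seminorms above generate; used only for Schwartz [g s] and [f]. *)
Definition schwartz_cvg (R : realType) (T : Type) (F : set_system T)
    (g : T -> R -> R) (f : R -> R) : Prop :=
  forall k n : nat,
    schwartz_seminorm k n (fun x => g s x - f x) @[s --> F] --> (0%E : \bar R).

(* [u] is a continuously differentiable curve in the Schwartz space, with
   derivative [v]. *)
Definition schwartz_C1 (R : realType) (u : R -> R -> R) : Prop :=
  (forall t : R, schwartz (u t)) /\
  exists v : R -> R -> R,
    [/\ forall t : R, schwartz (v t),
        forall t : R, schwartz_cvg (0^' : set_system R)
          (fun h x => h^-1 * (u (t + h) x - u t x)) (v t)
      & forall t : R, schwartz_cvg (nbhs t) v (v t)].

(* Here and below [u t x] is the value at time [t] and position [x].  For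
   [schwartz_C1 u] and [1 < p], all the derivatives below exist. *)
Definition defocusing_gKdV (R : realType) (p : R) (u : R -> R -> R) : Prop :=
  forall t x : R,
    derive1 (fun s => u s x) t + derive1n 3 (u t) x =
    derive1 (fun y => `|u t y| `^ (p - 1) * u t y) x.

Definition global_schwartz_solution (R : realType) (p : R)
    (u : R -> R -> R) : Prop :=
  schwartz_C1 u /\ defocusing_gKdV p u.

(* Main.v *)
Require Import Defs.
From mathcomp Require Import all_boot all_order all_algebra.
From mathcomp Require Import all_classical all_reals all_analysis.
From mathcomp Require Import measurable_realfun ring lra.
Import Order.TTheory GRing.Theory Num.Theory.
Import numFieldNormedType.Exports.
Local Open Scope classical_set_scope.
Local Open Scope ring_scope.

(* Write M and E for the mass and energy, X and Y for the first moments of their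
   densities.  Then M and E are conserved, X' = -S and Y' = -L, where, with g = -u_xx and
   h = |u|^(p-1) u,
     S = 3 int u_x^2 + 2p/(p+1) int u h,
     L = int (3/2 g^2 + 2 g h + 1/2 h^2).
   Since int g h >= 0, L >= 1/2 int (sqrt 3 g + h)^2, and Cauchy-Schwarz against u gives
   L M >= S E + c (int u h)^2 with c > 0; this is where p >= sqrt 3 enters.  Hence the
   separation G = X/M - Y/E of the centers of mass and energy satisfies
   G' = L/E - S/M > 0.  If int (x - x(t))^2 u^2 <= K for all t, then int u h is bounded
   below, so G' >= d > 0, while X/M - x(t) and Y/E - x(t) are O(1) and O(sqrt L), so
   G^2 <= a + b G'.  Therefore 1 + G^2 <= c' G', and such a G blows up in finite time. *)

(** * Rapidly decreasing functions *)

Section RapidDecay.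
Set Implicit Arguments.
Unset Strict Implicit.
Context (R : realType).
Implicit Types f g h df dg : R -> R.

(** The derivative is carried as an explicit function, so that formulas for it are assembled
    structurally and then compared by [ring] or [field]. *)
Definition has_deriv f df := forall x, is_derive x (1 : R) f (df x).

Lemma has_derivD f g df dg : has_deriv f df -> has_deriv g dg ->
  has_deriv (fun x => f x + g x) (fun x => df x + dg x).
Proof. by move=> Hf Hg x; apply: is_deriveD. Qed.

Lemma has_derivB f g df dg : has_deriv f df -> has_deriv g dg ->
  has_deriv (fun x => f x - g x) (fun x => df x - dg x).
Proof. by move=> Hf Hg x; apply: is_deriveB. Qed.

Lemma has_derivZ c f df : has_deriv f df ->
  has_deriv (fun x => c * f x) (fun x => c * df x).
Proof. by move=> Hf x; apply: is_deriveZ. Qed.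

Lemma has_derivM f g df dg : has_deriv f df -> has_deriv g dg ->
  has_deriv (fun x => f x * g x) (fun x => df x * g x + f x * dg x).
Proof.
move=> Hf Hg x; apply: (is_derive_eq (is_deriveM (Hf x) (Hg x))).
by rewrite addrC /GRing.scale /= mulrC.
Qed.

Lemma has_deriv_id : has_deriv (fun x => x) (fun=> 1).
Proof. by move=> x; apply: is_derive_id. Qed.

Lemma has_deriv_cst c : has_deriv (fun=> c) (fun=> 0).
Proof. by move=> x; apply: is_derive_cst. Qed.

Lemma has_deriv_comp f g df dg : has_deriv f df -> has_deriv g dg ->
  has_deriv (fun x => g (f x)) (fun x => dg (f x) * df x).
Proof.
move=> Hf Hg x.
exact: (@is_derive1_comp R g f x _ _ (Hg (f x)) (Hf x)).
Qed.

Lemma has_deriv_eq f df dg : has_deriv f df -> (forall x, df x = dg x) -> has_deriv f dg.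
Proof. by move=> Hf e x; rewrite -e. Qed.

Lemma has_deriv_continuous f df : has_deriv f df -> continuous f.
Proof.
move=> Hf x; apply: differentiable_continuous.
by apply/derivable1_diffP; apply: (@ex_derive _ _ _ _ _ _ _ (Hf x)).
Qed.

(** Decay is asked of the function alone, not of its derivatives: |u|^(p-1) u is in general not
    smooth where u vanishes, so it decays like a Schwartz function without being one. *)
Definition rapid f := continuous f /\
  forall k, exists C, forall x, `|x| ^+ k * `|f x| <= C.

Lemma rapidD f g : rapid f -> rapid g -> rapid (fun x => f x + g x).
Proof.
move=> [cf Hf] [cg Hg]; split; first by move=> x; apply: cvgD; [exact: cf|exact: cg].
move=> k; have [C HC] := Hf k; have [D HD] := Hg k; exists (C + D) => x.
apply: le_trans (lerD (HC x) (HD x)); rewrite -mulrDr.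
by rewrite ler_wpM2l ?exprn_ge0 // ler_normD.
Qed.

Lemma rapid_bddM f g : continuous f -> (exists C, forall x, `|f x| <= C) ->
  rapid g -> rapid (fun x => f x * g x).
Proof.
move=> cf [C HC] [cg Hg]; split; first by move=> x; apply: cvgM; [exact: cf|exact: cg].
move=> k; have [D HD] := Hg k; exists (C * D) => x.
rewrite normrM mulrCA; by apply: ler_pM => //; apply: mulr_ge0.
Qed.

Lemma rapid_bdd f : rapid f -> exists C, forall x, `|f x| <= C.
Proof.
by move=> [_ /(_ 0%N)[C HC]]; exists C => x; have := HC x; rewrite expr0 mul1r.
Qed.

Lemma rapidM f g : rapid f -> rapid g -> rapid (fun x => f x * g x).
Proof. by move=> Hf Hg; apply: rapid_bddM => //; [case: Hf|exact: rapid_bdd]. Qed.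

Lemma rapidZ c f : rapid f -> rapid (fun x => c * f x).
Proof.
apply: (@rapid_bddM (fun=> c)); first by move=> x; exact: cvg_cst.
by exists `|c|.
Qed.

Lemma rapidB f g : rapid f -> rapid g -> rapid (fun x => f x - g x).
Proof.
move=> Hf /(rapidZ (-1)) Hg.
rewrite (_ : (fun x => _) = (fun x => f x + -1 * g x)); first exact: rapidD.
by apply/funext => x; rewrite mulN1r.
Qed.

Lemma rapidX f : rapid f -> rapid (fun x => x * f x).
Proof.
move=> [cf Hf]; split; first by move=> x; apply: cvgM; [exact: cvg_id|exact: cf].
move=> k; have [C HC] := Hf k.+1; exists C => x.
by rewrite normrM mulrA -exprSr.
Qed.

Lemma eq_rapid f g : rapid f -> (forall x, f x = g x) -> rapid g.
Proof. by move=> Hf /funext <-. Qed.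

Notation mu := (@lebesgue_measure R).

(** By evenness the integral is twice the one over the half-line, which is known. This function is
    the common majorant for all rapid functions. *)
Lemma integrable_oneDsqrV : mu.-integrable setT (EFin \o (fun x => (oneDsqr x)^-1)).
Proof.
have mo : measurable_fun setT (fun x : R => (oneDsqr x)^-1).
  by apply: continuous_measurable_fun; exact: continuous_oneDsqrV.
apply/integrableP; split; first exact/measurable_EFinP.
under eq_integral => x _ do
  rewrite /= ger0_norm ?invr_ge0 ?(le_trans _ (oneDsqr_ge1 x)) //.
rewrite ge0_symfun_integralT; last 3 first.
- by move=> x; rewrite invr_ge0 (le_trans _ (oneDsqr_ge1 x)).
- exact: continuous_oneDsqrV.
- by move=> x; rewrite /= /oneDsqr sqrrN.
by rewrite -set_itvcy integral0y_oneDsqr -EFinM ltry.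
Qed.

Lemma rapid_oneDsqr f : rapid f -> exists C, forall x, `|f x| <= C * (oneDsqr x)^-1.
Proof.
move=> [_ Hf]; have [C HC] := Hf 0%N; have [D HD] := Hf 2%N; exists (C + D) => x.
rewrite ler_pdivlMr; last by rewrite (lt_le_trans ltr01) ?oneDsqr_ge1.
rewrite /oneDsqr mulrDr mulr1; apply: lerD.
  by have := HC x; rewrite expr0 mul1r.
by have := HD x; rewrite mulrC real_normK ?num_real.
Qed.

Lemma rapid_measurable f : rapid f -> measurable_fun setT f.
Proof. by move=> [cf _]; exact: continuous_measurable_fun. Qed.

Lemma rapid_integrable f : rapid f -> mu.-integrable setT (EFin \o f).
Proof.
move=> Hf; have [C HC] := rapid_oneDsqr Hf.
apply: (le_integrable _ _ _ (integrableZl measurableT C integrable_oneDsqrV)) => //.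
  by apply/measurable_EFinP; exact: rapid_measurable.
move=> x _ /=; rewrite lee_fin (le_trans (HC x)) // ler_norm //.
Qed.

Definition integ f := \int[mu]_x f x.

Lemma integ_EFin f : rapid f -> (\int[mu]_x (f x)%:E)%E = (integ f)%:E.
Proof.
move=> Hf; rewrite /integ /Rintegral fineK //.
by apply: integrable_fin_num => //; exact: rapid_integrable.
Qed.

Lemma integD f g : rapid f -> rapid g ->
  integ (fun x => f x + g x) = integ f + integ g.
Proof. by move=> Hf Hg; apply: RintegralD => //; exact: rapid_integrable. Qed.

Lemma integB f g : rapid f -> rapid g ->
  integ (fun x => f x - g x) = integ f - integ g.
Proof. by move=> Hf Hg; apply: RintegralB => //; exact: rapid_integrable. Qed.

Lemma integZ c f : rapid f -> integ (fun x => c * f x) = c * integ f.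
Proof. by move=> Hf; apply: RintegralZl => //; exact: rapid_integrable. Qed.

Lemma integ_ge0 f : (forall x, 0 <= f x) -> 0 <= integ f.
Proof. by move=> Hf; apply: Rintegral_ge0. Qed.

Lemma eq_integ f g : (forall x, f x = g x) -> integ f = integ g.
Proof. by move=> /funext ->. Qed.

Lemma rapid_cvg0 f : rapid f -> f n%:R @[n --> \oo] --> 0 /\ f (- n%:R) @[n --> \oo] --> 0.
Proof.
move=> [_ /(_ 1%N)[C HC]].
have C0 : 0 <= C by apply: le_trans (HC 0); rewrite normr0 expr1 mul0r.
suff H (s : R) : `|s| = 1 -> f (s * n%:R) @[n --> \oo] --> 0.
  split.
    by under eq_cvg do rewrite -[X in f X]mul1r; apply: H; rewrite normr1.
  by under eq_cvg do rewrite -[X in f X]mulN1r; apply: H; rewrite normrN1.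
move=> s1; apply/norm_cvg0P.
apply: (@squeeze_cvgr _ _ _ _ (fun=> 0) (fun n : nat => C * n%:R^-1)).
- near=> n; rewrite normr_ge0 /= ler_pdivlMr; last first.
    by rewrite ltr0n; near: n; exact: nbhs_infty_gt.
  have := HC (s * n%:R); rewrite expr1 normrM s1 mul1r normr_nat mulrC //.
- exact: cvg_cst.
- rewrite -(mulr0 C); apply: cvgMr; apply/gtr0_cvgV0.
    by near=> n; rewrite ltr0n; near: n; exact: nbhs_infty_gt.
  exact: cvgr_idn.
Unshelve. all: by end_near. Qed.

(** The fundamental theorem of calculus on [-n, n] gives boundary values that tend to 0, while
    dominated convergence, with majorant |df|, handles the left-hand side. All integrations by parts
    below reduce to this. *)
Lemma integ_deriv f df : has_deriv f df -> rapid f -> rapid df -> integ df = 0.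
Proof.
move=> fdf rf rdf.
pose D n := `[- n%:R, n%:R]%classic : set R.
have mD n : measurable (D n) by exact: measurable_itv.
have fn n : (\int[mu]_x ((df \_ (D n)) x)%:E)%E = (f n%:R - f (- n%:R))%:E.
  rewrite (_ : (fun x => _) = (EFin \o df) \_ (D n)); last by rewrite restrict_EFin.
  rewrite -integral_mkcond.
  (* For n = 0 the interval is a point, which [continuous_FTC2] does not cover. *)
  case: n => [|n].
    by rewrite /D oppr0 set_itv1 integral_set1 subrr.
  rewrite (@continuous_FTC2 _ _ f) -?EFinB //.
  - by rewrite -subr_gt0 opprK addr_gt0 // ltr0n.
  - by apply: continuous_subspaceT; case: rdf.
  - have cf := has_deriv_continuous fdf; split.
    + by move=> x _; apply: (@ex_derive _ _ _ _ _ _ _ (fdf x)).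
    + by apply: cvg_at_right_filter; exact: cf.
    + by apply: cvg_at_left_filter; exact: cf.
  - by move=> x _; rewrite derive1E; exact: (@derive_val _ _ _ _ _ _ _ (fdf x)).
have H : (\int[mu]_x ((df \_ (D n)) x)%:E)%E @[n --> \oo] --> (\int[mu]_x (df x)%:E)%E.
  have mdf := rapid_measurable rdf.
  have [] := @dominated_convergence _ _ R mu setT measurableT
    (fun n x => ((df \_ (D n)) x)%:E) (EFin \o df) (EFin \o (fun x => `|df x|)) => //.
  - move=> n; apply/measurable_EFinP.
    by apply/(measurable_restrictT _ (mD n)); exact: measurable_funTS.
  - exact/measurable_EFinP.
  - apply: aeW => x _; apply: cvg_near_cst; near=> n.
    rewrite patchE mem_set // /D /= in_itv /=.
    have : `|x| <= n%:R by near: n; exact: nbhs_infty_ger.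
    by rewrite ler_norml.
  - have := integrable_abse (rapid_integrable rdf).
    by rewrite (_ : abse \o _ = EFin \o (fun x => `|df x|)).
  - apply: aeW => x n _ /=; rewrite lee_fin patchE; case: ifP => // _.
    by rewrite normr0.
have {}H : (f n%:R - f (- n%:R))%:E @[n --> \oo] --> (integ df)%:E.
  by rewrite -integ_EFin //; under eq_cvg do rewrite -fn.
have H0 : f n%:R - f (- n%:R) @[n --> \oo] --> 0.
  rewrite -(subr0 0); have [? ?] := rapid_cvg0 rf; exact: cvgB.
have /fine_cvg /= H1 := H.
exact: (cvg_unique _ H1 H0).
Unshelve. all: by end_near. Qed.

End RapidDecay.

(** * Differentiation in time *)

Section CurveDerivatives.
Set Implicit Arguments.
Unset Strict Implicit.
Context (R : realType).
Implicit Types f g h df dg : R -> R.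

(** Integration by parts in the form used below: it suffices to exhibit a rapid primitive of the
    difference of the integrands. *)
Lemma integ_eq_deriv f g h : has_deriv h (fun x => f x - g x) ->
  rapid h -> rapid f -> rapid g -> integ f = integ g.
Proof.
move=> dh rh rf rg; apply/eqP; rewrite -subr_eq0 -integB //.
by rewrite (integ_deriv dh) //; exact: rapidB.
Qed.

(** The integral of (s f + t g)^2 is a nonnegative quadratic form in (s, t), to be evaluated at
    well-chosen points. *)
Lemma integ_Cauchy_Schwarz f g : rapid f -> rapid g ->
  integ (fun x => f x * g x) ^+ 2 <=
  integ (fun x => f x ^+ 2) * integ (fun x => g x ^+ 2).
Proof.
move=> rf rg.
set a := integ (fun x => f x ^+ 2); set b := integ _; set c := integ _.
have Q (s t : R) : 0 <= s ^+ 2 * a + 2 * s * t * b + t ^+ 2 * c.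
  have rff := rapidM rf rf; have rfg := rapidM rf rg; have rgg := rapidM rg rg.
  have : 0 <= integ (fun x => (s * f x + t * g x) ^+ 2).
    by apply: integ_ge0 => x; exact: sqr_ge0.
  rewrite (@eq_integ _ _ (fun x => s ^+ 2 * (f x * f x) + 2 * s * t * (f x * g x)
    + t ^+ 2 * (g x * g x))); last by move=> x; ring.
  by rewrite !integD ?integZ //; do ?[exact: rapidZ|apply: rapidD].
have a0 : 0 <= a by rewrite /a; apply: integ_ge0 => x; exact: sqr_ge0.
have c0 : 0 <= c by rewrite /c; apply: integ_ge0 => x; exact: sqr_ge0.
have [cp|] := ltP 0 c.
  have := Q c (- b).
  have -> : c ^+ 2 * a + 2 * c * - b * b + (- b) ^+ 2 * c = c * (a * c - b ^+ 2) by ring.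
  by rewrite pmulr_rge0 // subr_ge0.
move=> cn; have c00 : c = 0 by apply/eqP; rewrite eq_le cn c0.
have [->|bn0] := eqVneq b 0; first by rewrite expr0n /= mulr_ge0.
(* With c = 0 the form is linear in t; this choice makes it equal to -b^2, which forces b = 0. *)
have := Q b (- (a + 1) / 2); rewrite c00.
have -> : b ^+ 2 * a + 2 * b * (- (a + 1) / 2) * b + (- (a + 1) / 2) ^+ 2 * 0 = - b ^+ 2 by field.
by rewrite oppr_ge0 mulr0.
Qed.

Lemma is_derive_cvg f (t l : R) :
  h^-1 * (f (t + h) - f t) @[h --> (0 : R)^'] --> l -> is_derive t (1 : R) f l.
Proof.
move=> H.
have {}H : h^-1 *: (f (h *: (1 : R) + t) - f t) @[h --> (0 : R)^'] --> l.
  by under eq_cvg => z do rewrite [z *: 1]mulr1 [z + t]addrC.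
apply: DeriveDef; first by apply/cvg_ex; exists l.
exact: (cvg_lim _ H).
Qed.

(** Differentiability at time [t] in all the sup norms weighted by |x|^k, without space derivatives.
    Unlike convergence in the Schwartz space, it survives composition with a nonlinearity that is
    not smooth. *)
Definition curve_deriv (u : R -> R -> R) (t : R) (v : R -> R) :=
  forall k (e : R), 0 < e -> \forall h \near (0 : R)^', forall x,
    `|x| ^+ k * `|h^-1 * (u (t + h) x - u t x) - v x| <= e.

(** The weights k = 0 and k = 2 together bound the error of the difference quotient by a small
    multiple of 1/(1 + x^2), which is integrable. *)
Lemma integ_time_deriv (u : R -> R -> R) t v :
  (forall s, rapid (u s)) -> rapid v -> curve_deriv u t v ->
  is_derive t (1 : R) (fun s => integ (u s)) (integ v).
Proof.
move=> ru rv uv; apply: is_derive_cvg.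
pose c := \int[lebesgue_measure]_x (oneDsqr (x : R))^-1.
have oV0 (x : R) : 0 <= (oneDsqr x)^-1 by rewrite invr_ge0 (le_trans _ (oneDsqr_ge1 x)).
have c0 : 0 <= c by apply: Rintegral_ge0.
apply/cvgrPdist_le => e e0.
(* Two such bounds add up to an error of at most e c/(c + 1) <= e after integration; c + 1 is
   positive without further argument. *)
have e10 : 0 < e / (2 * (c + 1)) by rewrite divr_gt0 // mulr_gt0 // ltr_wpDl.
have N0 := uv 0%N _ e10; have N2 := uv 2%N _ e10.
near=> h.
have h0 := near N0 h; have h2 := near N2 h.
have rd : rapid (fun x => h^-1 * (u (t + h) x - u t x) - v x).
  by apply: rapidB => //; apply: rapidZ; apply: rapidB.
have -> : integ v - h^-1 * (integ (u (t + h)) - integ (u t)) =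
    - integ (fun x => h^-1 * (u (t + h) x - u t x) - v x).
  rewrite integB //; last by apply: rapidZ; apply: rapidB.
  by rewrite integZ ?integB ?opprB //; apply: rapidB.
rewrite normrN; apply: (le_trans (le_normr_Rintegral _ _)) => //.
  exact: rapid_integrable.
apply: (@le_trans _ _ (\int[lebesgue_measure]_x (2 * (e / (2 * (c + 1))) * (oneDsqr x)^-1))).
  apply: le_Rintegral => //.
  - exact: (integrable_abse (rapid_integrable rd)).
  - exact: (integrableZl measurableT (2 * (e / (2 * (c + 1)))) (@integrable_oneDsqrV R)).
  - move=> x _; rewrite ler_pdivlMr; last by rewrite (lt_le_trans ltr01) ?oneDsqr_ge1.
    rewrite /oneDsqr mulrDr mulr1 mulr_natl mulr2n.
    apply: lerD.
      by rewrite -[leLHS]mul1r; exact: h0.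
    by rewrite mulrC -[x ^+ 2]real_normK ?num_real //; exact: h2.
rewrite RintegralZl //; last exact: integrable_oneDsqrV.
rewrite -/c invfM.
have -> : 2 * (e * (2^-1 / (c + 1))) * c = e * (c / (c + 1)) by field; lra.
have cp : 0 < c + 1 by rewrite ltr_wpDl.
by rewrite ler_piMr ?(ltW e0) // ler_pdivrMr // mul1r lerDl.
Unshelve. all: by end_near. Qed.

Lemma curve_derivX u t v : curve_deriv u t v ->
  curve_deriv (fun s x => x * u s x) t (fun x => x * v x).
Proof.
move=> H k e e0; near=> h => x.
have -> : h^-1 * (x * u (t + h) x - x * u t x) - x * v x =
  x * (h^-1 * (u (t + h) x - u t x) - v x) by ring.
by rewrite normrM mulrA -exprSr; move: x; near: h; exact: H.
Unshelve. all: by end_near. Qed.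

Lemma curve_derivZ c u t v : curve_deriv u t v ->
  curve_deriv (fun s x => c * u s x) t (fun x => c * v x).
Proof.
move=> H k e e0.
have e1 : 0 < e / (`|c| + 1) by rewrite divr_gt0 // ltr_wpDl.
near=> h => x.
have -> : h^-1 * (c * u (t + h) x - c * u t x) - c * v x =
  c * (h^-1 * (u (t + h) x - u t x) - v x) by ring.
rewrite normrM mulrCA.
apply: (@le_trans _ _ (`|c| * (e / (`|c| + 1)))).
  by rewrite ler_wpM2l //; move: x; near: h; exact: H.
have cp : 0 < `|c| + 1 by rewrite ltr_wpDl.
by rewrite mulrCA ler_piMr ?(ltW e0) // ler_pdivrMr // mul1r lerDl.
Unshelve. all: by end_near. Qed.

Lemma curve_derivD u1 u2 t v1 v2 : curve_deriv u1 t v1 -> curve_deriv u2 t v2 ->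
  curve_deriv (fun s x => u1 s x + u2 s x) t (fun x => v1 x + v2 x).
Proof.
move=> H1 H2 k e e0; have e2 : 0 < e / 2 by rewrite divr_gt0.
near=> h => x.
have -> : h^-1 * (u1 (t + h) x + u2 (t + h) x - (u1 t x + u2 t x)) - (v1 x + v2 x) =
  (h^-1 * (u1 (t + h) x - u1 t x) - v1 x) + (h^-1 * (u2 (t + h) x - u2 t x) - v2 x) by ring.
rewrite [e]splitr.
apply: (le_trans (ler_wpM2l _ (ler_normD _ _))); first exact: exprn_ge0.
rewrite mulrDr; apply: lerD; move: x; near: h; [exact: H1|exact: H2].
Unshelve. all: by end_near. Qed.

(** Chain rule. The quadratic Taylor remainder of G, divided by h, is O(|h|) in every weighted norm;
    the linear part inherits the convergence of the difference quotient because dG is bounded on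
    bounded sets. *)
Lemma curve_deriv_comp (G dG : R -> R) u t v :
  (forall C, exists D, 0 <= D /\ forall a b, `|a| <= C -> `|b| <= C ->
     `|G b - G a - dG a * (b - a)| <= D * (b - a) ^+ 2) ->
  (forall C, exists D, 0 <= D /\ forall a, `|a| <= C -> `|dG a| <= D) ->
  rapid (u t) -> rapid v -> curve_deriv u t v ->
  curve_deriv (fun s x => G (u s x)) t (fun x => dG (u t x) * v x).
Proof.
move=> HG HdG ru rv uv k e e0.
have [C0 HC0] := rapid_bdd ru; have [C1 HC1] := rapid_bdd rv.
have [V HV] := rv.2 k.
have C00 : 0 <= C0 by apply: le_trans (HC0 0).
have C10 : 0 <= C1 by apply: le_trans (HC1 0).
have V0 : 0 <= V by apply: le_trans (HV 0); apply: mulr_ge0 => //; exact: exprn_ge0.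
(* For |h| <= 1 this radius contains the values of both u(t) and u(t + h). *)
have [D [D0 HD]] := HG (C0 + (C1 + 1)); have [B [B0 HB]] := HdG (C0 + (C1 + 1)).
pose A := D * (C1 + 1) * (V + 1).
have A0 : 0 <= A by rewrite !mulr_ge0 // addr_ge0.
have N1 := uv 0%N _ (@ltr01 R); have Nk := uv k _ (@ltr01 R).
have e1 : 0 < e / 2 / (B + 1) by rewrite !divr_gt0 // ltr_wpDl.
have e2 : 0 < e / 2 / (A + 1) by rewrite !divr_gt0 // ltr_wpDl.
have Ne := uv k _ e1.
near=> h => x.
have hn0 : h != 0 by near: h; exact: nbhs_dnbhs_neq.
have h1 : `|h| <= 1 by near: h; exact: dnbhs0_le.
have h2 : `|h| <= e / 2 / (A + 1) by near: h; exact: dnbhs0_le.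
have He : `|x| ^+ k * `|h^-1 * (u (t + h) x - u t x) - v x| <= e / 2 / (B + 1).
  by move: x; near: h.
have Hk : `|x| ^+ k * `|h^-1 * (u (t + h) x - u t x) - v x| <= 1.
  by move: x {He}; near: h.
have H1 : `|h^-1 * (u (t + h) x - u t x) - v x| <= 1.
  by rewrite -[leLHS]mul1r; move: x {He Hk}; near: h.
move: He Hk H1.
set a := u t x; set b := u (t + h) x; set d := h^-1 * (b - a) => He Hk H1.
have bah : b - a = h * d by rewrite /d mulVKf.
have dv : `|d| <= `|v x| + `|d - v x| by rewrite -{1}(subrKC (v x) d) ler_normD.
have d1 : `|d| <= C1 + 1 by apply: le_trans dv _; exact: lerD.
have a1 : `|a| <= C0 + (C1 + 1) by apply: le_trans (HC0 x) _; rewrite lerDl addr_ge0.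
have b1 : `|b| <= C0 + (C1 + 1).
  rewrite -(subrKC a b) bah; apply: le_trans (ler_normD _ _) _.
  apply: lerD; first exact: HC0.
  by rewrite normrM -[leRHS]mul1r; apply: ler_pM.
have -> : h^-1 * (G b - G a) - dG a * v x =
    h^-1 * (G b - G a - dG a * (b - a)) + dG a * (d - v x).
  by rewrite /d; field.
apply: le_trans (ler_wpM2l (exprn_ge0 _ (normr_ge0 x)) (ler_normD _ _)) _.
rewrite mulrDr [e]splitr; apply: lerD.
  rewrite normrM normfV.
  apply: (@le_trans _ _ (`|x| ^+ k * (`|h|^-1 * (D * (b - a) ^+ 2)))).
    by rewrite ler_wpM2l ?exprn_ge0 // ler_wpM2l ?invr_ge0 //; exact: HD.
  rewrite bah -[(h * d) ^+ 2]real_normK ?num_real // normrM.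
  (* One factor |d| is bounded by C1 + 1, the other absorbs the weight, |x|^k |d| <= V + 1, and a
     factor |h| is left over. *)
  have -> : `|x| ^+ k * (`|h|^-1 * (D * (`|h| * `|d|) ^+ 2)) =
     D * `|d| * (`|x| ^+ k * `|d|) * `|h|.
    by field; rewrite normr_eq0.
  apply: (@le_trans _ _ (A * `|h|)).
    rewrite ler_wpM2r //; apply: ler_pM.
    - by rewrite mulr_ge0.
    - by rewrite mulr_ge0 // exprn_ge0.
    - by rewrite ler_wpM2l.
    - apply: le_trans (ler_wpM2l (exprn_ge0 _ (normr_ge0 x)) dv) _.
      by rewrite mulrDr lerD.
  apply: le_trans (ler_wpM2l A0 h2) _.
  have cp : 0 < A + 1 by rewrite ltr_wpDl.
  rewrite mulrCA ler_piMr ?ler_pdivrMr // ?mul1r ?lerDl //.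
  by rewrite ltW ?divr_gt0.
rewrite normrM mulrCA.
apply: le_trans (ler_pM _ _ (HB _ a1) He) _ => //.
have cp : 0 < B + 1 by rewrite ltr_wpDl.
rewrite mulrCA ler_piMr ?ler_pdivrMr // ?mul1r ?lerDl //.
by rewrite ltW ?divr_gt0.
Unshelve. all: by end_near. Qed.

End CurveDerivatives.

(** * The power nonlinearity *)

Section PowerNonlinearity.
Set Implicit Arguments.
Unset Strict Implicit.
Context (R : realType).
Implicit Types f g h df dg : R -> R.

(** The mean value theorem is applied to f and then to df. This yields the constant L instead of the
    sharp L/2, which is enough for [curve_deriv_comp]. *)
Lemma taylor2 f df ddf (C L : R) : has_deriv f df -> has_deriv df ddf ->
  (forall a, `|a| <= C -> `|ddf a| <= L) ->
  forall a b, `|a| <= C -> `|b| <= C ->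
    `|f b - f a - df a * (b - a)| <= L * (b - a) ^+ 2.
Proof.
have key g dg : has_deriv g dg -> forall a b, exists c,
    [/\ `|c - a| <= `|b - a|, `|c| <= Order.max `|a| `|b| & g b - g a = dg c * (b - a)].
  move=> H a b; have cg := has_deriv_continuous H.
  have M x y : x <= y -> exists2 c, c \in `[x, y] & g y - g x = dg c * (y - x).
    move=> xy; apply: MVT_segment => //; last exact: continuous_subspaceT.
  have between (x c y : R) : x <= c -> c <= y -> `|c| <= Order.max `|x| `|y|.
    move=> xc cy; rewrite le_max; apply/orP; have [c0|c0] := leP 0 c.
      by right; rewrite (ger0_norm c0); exact: le_trans cy (ler_norm _).
    left; rewrite (ltr0_norm c0) -normrN.
    by apply: le_trans (ler_norm _); rewrite lerN2.
  case: (leP a b) => [ab|/ltW ba].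
    have [c /[!in_itv] /= /andP[ac cb] e] := M _ _ ab; exists c; split => //.
      by rewrite !ger0_norm ?subr_ge0 // lerB.
    exact: between.
  have [c /[!in_itv] /= /andP[ac cb] e] := M _ _ ba; exists c; split => //.
  - by rewrite !ler0_norm ?subr_le0 // !opprB lerB.
  - by rewrite maxC; exact: between.
  - by rewrite -[LHS]opprB e -mulrN opprB.
move=> Hf Hdf HL a b aC bC.
have [c [ca cC ->]] := key _ _ Hf a b.
have [d [da dC e]] := key _ _ Hdf a c.
have cC' : `|c| <= C by apply: le_trans cC _; rewrite ge_max aC.
have dC' : `|d| <= C by apply: le_trans dC _; rewrite ge_max aC.
rewrite -mulrBl e !normrM -(real_normK (num_real (b - a))) expr2 mulrA.
by rewrite ler_wpM2r // ler_pM //; exact: HL.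
Qed.

Context (q : R) (q0 : 0 < q).
Implicit Types s C : R.
(** Used with q = p - 1. Then [fpw] is the nonlinearity |s|^(p-1) s and [Fpw] its primitive
    |s|^(p+1)/(p+1). *)
Definition pw (s : R) := `|s| `^ q.

Lemma pw_ge0 s : 0 <= pw s. Proof. exact: powR_ge0. Qed.

Lemma pw0 : pw 0 = 0. Proof. by rewrite /pw normr0 powR0 // gt_eqF. Qed.

Lemma le_pw s C : `|s| <= C -> pw s <= C `^ q.
Proof.
by move=> sC; rewrite ge0_ler_powR ?nnegrE ?(ltW q0) //; apply: le_trans sC.
Qed.

Lemma pw_cvg0 : pw h @[h --> (0 : R)^'] --> 0.
Proof.
apply/cvgrPdist_le => e e0; near=> h.
rewrite sub0r normrN ger0_norm ?pw_ge0 //.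
have -> : e = (e `^ q^-1) `^ q by rewrite -powRrM mulVf ?gt_eqF // powRr1 // ltW.
by apply: le_pw; near: h; apply: dnbhs0_le; exact: powR_gt0.
Unshelve. all: by end_near. Qed.

Definition fpw s := pw s * s.

Lemma fpw_gt0_deriv (s : R) : 0 < s -> is_derive s (1 : R) fpw ((q + 1) * pw s).
Proof.
move=> s0.
have H : is_derive s (1 : R) (fun z => z `^ q * z) ((q + 1) * pw s).
  apply: (is_derive_eq (is_deriveM (is_derive1_powR q s0) (is_derive_id s 1))).
  rewrite /GRing.scale /= mulr1 mulrCA mulr_powRB1 ?(ltW s0) //.
  by rewrite /pw gtr0_norm //; ring.
apply: near_eq_is_derive H.
near=> z; rewrite /fpw /pw gtr0_norm //.
by near: z; exact: lt_nbhsr.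
Unshelve. all: by end_near. Qed.

(** At 0 the difference quotient is |h|^q, which tends to 0; negative points follow from positive
    ones by oddness. *)
Lemma has_deriv_fpw : has_deriv fpw (fun s => (q + 1) * pw s).
Proof.
move=> s; have [s0|s0|->] := ltgtP s 0; last 1 first.
- rewrite pw0 mulr0; apply: is_derive_cvg.
  apply: cvg_trans pw_cvg0; apply: near_eq_cvg; near=> h.
  rewrite /fpw pw0 mul0r subr0 add0r mulrA mulrAC mulVf ?mul1r //.
  by near: h; exact: nbhs_dnbhs_neq.
- have pN z : pw (- z) = pw z by rewrite /pw normrN.
  have e : fpw = fun z => -1 * fpw (-1 * z).
    by apply/funext => z; rewrite /fpw !mulN1r pN mulrN opprK.
  rewrite {1}e.
  have Ns : 0 < -1 * s by rewrite mulN1r oppr_gt0.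
  have H1 : is_derive s (1 : R) (fun z => -1 * z) (-1).
    by apply: (is_derive_eq (is_deriveZ (-1) (is_derive_id s 1))); rewrite [LHS]mulr1.
  have H2 := @is_derive1_comp R fpw _ s _ _ (fpw_gt0_deriv Ns) H1.
  apply: (is_derive_eq (is_deriveZ (-1) H2)).
  by rewrite [LHS]mulN1r mulrN1 opprK mulN1r pN.
- exact: fpw_gt0_deriv.
Unshelve. all: by end_near. Qed.

(** Away from 0, [pw] is the quotient of the differentiable [fpw] by the identity; at 0 it is
    [pw_cvg0]. *)
Lemma pw_continuous : continuous pw.
Proof.
move=> s; have [s0|s0] := eqVneq s 0.
  by rewrite s0; apply/continuous_withinNx; rewrite pw0; exact: pw_cvg0.
have H : {for s, continuous (fun z => fpw z / z)}.
  apply: cvgM; last by apply: cvgV => //; exact: cvg_id.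
  exact: (has_deriv_continuous has_deriv_fpw).
have e z : z != 0 -> pw z = fpw z / z by move=> z0; rewrite /fpw mulfK.
rewrite /continuous_at e //; apply: cvg_trans H; apply: near_eq_cvg.
near=> z; rewrite e //.
near: z; exact: open_neq.
Unshelve. all: by end_near. Qed.

Definition Fpw s := (q + 2)^-1 * (fpw s * s).

Lemma has_deriv_Fpw : has_deriv Fpw fpw.
Proof.
apply: (has_deriv_eq (has_derivZ _ (has_derivM has_deriv_fpw (@has_deriv_id R)))) => s.
by rewrite /fpw; field; rewrite gt_eqF // addr_gt0.
Qed.

End PowerNonlinearity.

(** * Mass, energy and their fluxes *)

Lemma rapidXB (R : realType) (y : R) (f : R -> R) :
  rapid f -> rapid (fun x => (x - y) * f x).
Proof.
move=> Hf; apply: (@eq_rapid _ (fun x => x * f x - y * f x)).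
  by apply: rapidB; [exact: rapidX|exact: rapidZ].
by move=> x; rewrite mulrBl.
Qed.

(** Structural descent on the integrand. Factors x, x - y and constants are not rapid and are
    treated apart. *)
Ltac prove_rapid := lazymatch goal with
  | |- rapid (fun x => @?f x - @?g x) => apply (@rapidB _ f g); prove_rapid
  | |- rapid (fun x => @?f x + @?g x) => apply (@rapidD _ f g); prove_rapid
  | |- rapid (fun x => @?f x * @?g x) => lazymatch f with
    | fun x => x => apply (@rapidX _ g); prove_rapid
    | fun _ => ?c => apply (@rapidZ _ c g); prove_rapid
    | fun x => x - @?y x => lazymatch y with fun _ => ?c => apply (@rapidXB _ c g); prove_rapid end
    | _ => apply (@rapidM _ f g); prove_rapid
    end
  | |- _ => assumption
  end.
Ltac prove_has_deriv := lazymatch goal with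
  | |- has_deriv (fun x => x) _ => apply has_deriv_id
  | |- has_deriv (fun _ => ?c) _ => apply (@has_deriv_cst _ c)
  | |- has_deriv (fun x => @?f x - @?g x) _ => eapply (@has_derivB _ f g); prove_has_deriv
  | |- has_deriv (fun x => @?f x + @?g x) _ => eapply (@has_derivD _ f g); prove_has_deriv
  | |- has_deriv (fun x => @?f x * @?g x) _ => eapply (@has_derivM _ f g); prove_has_deriv
  | |- _ => eassumption
  end.

Section Functionals.
Set Implicit Arguments.
Unset Strict Implicit.
Context (R : realType).
Implicit Types u : R -> R.

Definition mass u := integ (fun x => u x * u x).
Definition mass_moment u := integ (fun x => x * (u x * u x)).
Definition potential u h := integ (fun x => h x * u x).
Definition energy u1 F := integ (fun x => 2^-1 * (u1 x * u1 x) + F x).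
Definition energy_moment u1 F :=
  integ (fun x => x * (2^-1 * (u1 x * u1 x) + F x)).
Definition mass_current (p : R) u u1 h :=
  3 * mass u1 + 2 * p / (p + 1) * potential u h.
(** The quantity L, with g = -[u2]; hence the minus sign in the cross term. *)
Definition energy_current u2 h := integ (fun x =>
  (3 / 2) * (u2 x * u2 x) - 2 * (u2 x * h x) + 2^-1 * (h x * h x)).

(* The solution at a fixed time: [u1 u2 u3] are the space derivatives of [u], [v] is its
   time derivative, [P] stands for |u|^(p-1), [h] for |u|^(p-1) u and [F] for
   |u|^(p+1)/(p+1). *)
Record gKdV_slice (p : R) (u u1 u2 u3 v v1 P h hd F : R -> R) : Prop := GKdVSlice {
  slice_du : has_deriv u u1;
  slice_du1 : has_deriv u1 u2;
  slice_du2 : has_deriv u2 u3;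
  slice_dv : has_deriv v v1;
  slice_dh : has_deriv h hd;
  slice_dF : has_deriv F (fun x => h x * u1 x);
  slice_ru : rapid u;
  slice_ru1 : rapid u1;
  slice_ru2 : rapid u2;
  slice_ru3 : rapid u3;
  slice_rv : rapid v;
  slice_rv1 : rapid v1;
  slice_rh : rapid h;
  slice_rhd : rapid hd;
  slice_rF : rapid F;
  slice_P0 : forall x, 0 <= P x;
  slice_hE : forall x, h x = P x * u x;
  slice_hdE : forall x, hd x = p * (P x * u1 x);
  slice_FE : forall x, F x = (p + 1)^-1 * (h x * u x);
  slice_vE : forall x, v x = - u3 x + hd x }.

End Functionals.

(** * Flux identities and inequalities at a fixed time *)

Section FluxIdentities.
Set Implicit Arguments.
Unset Strict Implicit.
Context (R : realType) (p : R) (p1 : 1 < p).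
Context (u u1 u2 u3 v v1 P h hd F : R -> R).
Hypothesis S : gKdV_slice p u u1 u2 u3 v v1 P h hd F.

Let du := slice_du S.
Let du1 := slice_du1 S.
Let du2 := slice_du2 S.
Let dv := slice_dv S.
Let dh := slice_dh S.
Let dF := slice_dF S.
Let ru := slice_ru S.
Let ru1 := slice_ru1 S.
Let ru2 := slice_ru2 S.
Let ru3 := slice_ru3 S.
Let rv := slice_rv S.
Let rv1 := slice_rv1 S.
Let rh := slice_rh S.
Let rhd := slice_rhd S.
Let rF := slice_rF S.
Let P0 := slice_P0 S.
Let hE := slice_hE S.
Let hdE := slice_hdE S.
Let FE := slice_FE S.
Let vE := slice_vE S.

Local Notation M := (mass u).
Local Notation A := (mass u1).
Local Notation B := (potential u h).
Local Notation E := (energy u1 F).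
Local Notation X := (mass_moment u).
Local Notation Y := (energy_moment u1 F).
Local Notation L := (energy_current u2 h).

Let p0 : 0 < p. Proof. exact: lt_trans p1. Qed.
Let q0 : 0 < p + 1. Proof. exact: addr_gt0. Qed.
Let p1n0 : p + 1 != 0. Proof. by rewrite gt_eqF. Qed.

Lemma mass_flux : integ (fun x => 2 * (u x * v x)) = 0.
Proof.
(* The time derivative of u^2 is the x-derivative of this flux. *)
apply: (@integ_deriv _ (fun x => -2 * (u x * u2 x) + (u1 x * u1 x + 2 * (u x * h x - F x))));
  [|prove_rapid..].
eapply has_deriv_eq; first by prove_has_deriv.
by move=> x /=; rewrite vE; ring.
Qed.

Lemma mass_moment_flux : integ (fun x => x * (2 * (u x * v x))) =
  - mass_current p u u1 h.
Proof.
rewrite /mass_current.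
have -> : - (3 * A + 2 * p / (p + 1) * B) =
   integ (fun x => (- 3) * (u1 x * u1 x) + (- (2 * p / (p + 1))) * (h x * u x)).
  by rewrite integD ?integZ -/(mass u1) -/(potential u h); [ring|prove_rapid..].
(* x times the mass flux leaves minus the flux itself; the term 2 u u_x trades -2 u u_xx for 2
   u_x^2, which gives the factor 3. *)
apply: (@integ_eq_deriv _ _ _ (fun x => x * (-2 * (u x * u2 x) + (u1 x * u1 x + 2 * (u x * h x - F x)))
   + 2 * (u x * u1 x))); [|prove_rapid..].
eapply has_deriv_eq; first by prove_has_deriv.
by move=> x /=; rewrite vE FE; field.
Qed.

Lemma energy_flux : integ (fun x => u1 x * v1 x + h x * v x) = 0.
Proof.
(* Since v is the x-derivative of w = h - u_xx, the integrand is (u_x v)' + w w'. *)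
apply: (@integ_deriv _ (fun x => u1 x * v x + 2^-1 * ((h x - u2 x) * (h x - u2 x))));
  [|prove_rapid..].
eapply has_deriv_eq; first by prove_has_deriv.
by move=> x /=; rewrite vE; field.
Qed.

Lemma energy_moment_flux : integ (fun x => x * (u1 x * v1 x + h x * v x)) = - L.
Proof.
have -> : - L = integ (fun x => -1 * ((3 / 2) * (u2 x * u2 x) - 2 * (u2 x * h x) + 2^-1 * (h x * h x))).
  by rewrite integZ; [rewrite -/(energy_current u2 h) mulN1r|prove_rapid].
(* As for the mass; the correction u_x (h - u_xx) removes the term u_x v from the flux. *)
apply: (@integ_eq_deriv _ _ _ (fun x => x * (u1 x * v x + 2^-1 * ((h x - u2 x) * (h x - u2 x)))
   - u1 x * (h x - u2 x))); [|prove_rapid..].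
eapply has_deriv_eq; first by prove_has_deriv.
by move=> x /=; rewrite vE; field.
Qed.

Let AE : A = - integ (fun x => u x * u2 x).
Proof.
have -> : - integ (fun x => u x * u2 x) = integ (fun x => -1 * (u x * u2 x)).
  by rewrite integZ; [rewrite mulN1r|prove_rapid].
apply: (@integ_eq_deriv _ _ _ (fun x => u x * u1 x)); [|prove_rapid..].
eapply has_deriv_eq; first by prove_has_deriv.
by move=> x /=; ring.
Qed.

Let EE : E = 2^-1 * A + (p + 1)^-1 * B.
Proof.
rewrite /energy integD ?integZ -/(mass u1); [|prove_rapid..]; congr (_ + _).
by rewrite /potential -integZ; [exact: eq_integ|prove_rapid].
Qed.

Let A0 : 0 <= A. Proof. by apply: integ_ge0 => x; rewrite -expr2 sqr_ge0. Qed.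
Let M0 : 0 <= M. Proof. by apply: integ_ge0 => x; rewrite -expr2 sqr_ge0. Qed.
Let B0 : 0 <= B.
Proof. by apply: integ_ge0 => x; rewrite hE -mulrA -expr2 mulr_ge0 ?sqr_ge0. Qed.

Let D := integ (fun x => u2 x * h x).
Let G2 := integ (fun x => u2 x * u2 x).
Let H2 := integ (fun x => h x * h x).
(** Integration by parts turns -D into p times the integral of |u|^(p-1) u_x^2. *)
Let D0 : D <= 0.
Proof.
rewrite -oppr_ge0.
have -> : - D = integ (fun x => hd x * u1 x).
  have -> : - D = integ (fun x => -1 * (u2 x * h x)).
    by rewrite integZ; [rewrite mulN1r|prove_rapid].
  apply: (@integ_eq_deriv _ _ _ (fun x => -1 * (u1 x * h x))); [|prove_rapid..].
  eapply has_deriv_eq; first by prove_has_deriv.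
  by move=> x /=; ring.
apply: integ_ge0 => x; rewrite hdE -mulrA mulr_ge0 ?(ltW p0) //.
by rewrite -mulrA -expr2 mulr_ge0 ?sqr_ge0.
Qed.
Let G20 : 0 <= G2. Proof. by apply: integ_ge0 => x; rewrite -expr2 sqr_ge0. Qed.
Let H20 : 0 <= H2. Proof. by apply: integ_ge0 => x; rewrite -expr2 sqr_ge0. Qed.

Let LE : L = (3 / 2) * G2 - 2 * D + 2^-1 * H2.
Proof. by rewrite /energy_current integD ?integB ?integZ //; prove_rapid. Qed.

Lemma energy_ge : (p + 1)^-1 * B <= E.
Proof. by rewrite EE lerDr mulr_ge0 ?invr_ge0. Qed.

(** The current is 6 (A/2) + 2p (B/(p+1)), and both brackets are nonnegative with sum E. *)
Lemma mass_current_le_energy : mass_current p u u1 h <= (6 + 2 * p) * E.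
Proof.
rewrite /mass_current.
have b0 : 0 <= (p + 1)^-1 * B.
  by rewrite mulr_ge0 ?invr_ge0 // ltW.
have -> : 3 * A + 2 * p / (p + 1) * B = 3 * A + 2 * p * ((p + 1)^-1 * B) by ring.
rewrite EE; have := A0; move: b0; set b := _ * B => b0 a0.
have : 0 <= p * A by rewrite mulr_ge0 // ltW.
nra.
Qed.

Lemma dispersion_ineq : Num.sqrt 3 <= p ->
  mass_current p u u1 h * E + (p - 1) ^+ 2 / (2 * (p + 1) ^+ 2) * B ^+ 2 <= L * M.
Proof.
rewrite /mass_current.
set r := Num.sqrt 3 => rp.
have r0 : 0 <= r by exact: sqrtr_ge0.
have r2 : r ^+ 2 = 3 by rewrite sqr_sqrtr.
(* Cauchy-Schwarz for h - r u_xx against u, with r = sqrt 3, using that A is minus the integral of u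
   u_xx. *)
have CS : (r * A + B) ^+ 2 <= (3 * G2 - 2 * r * D + H2) * M.
  have -> : r * A + B = integ (fun x => (h x - r * u2 x) * u x).
    rewrite (@eq_integ _ _ (fun x => h x * u x - r * (u x * u2 x))); last by move=> x; ring.
    by rewrite integB ?integZ ?AE -/(potential u h); [ring|prove_rapid..].
  have -> : 3 * G2 - 2 * r * D + H2 = integ (fun x => (h x - r * u2 x) ^+ 2).
    rewrite (@eq_integ _ _ (fun x => r ^+ 2 * (u2 x * u2 x) - 2 * r * (u2 x * h x) + h x * h x));
      last by move=> x; ring.
    by rewrite integD ?integB ?integZ -?/G2 -?/D -?/H2 ?r2; [ |prove_rapid..].
  have -> : M = integ (fun x => u x ^+ 2) by apply: eq_integ => x; rewrite expr2.
  by apply: integ_Cauchy_Schwarz; prove_rapid.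
have rle2 : r <= 2 by nra.
have r1 : 1 <= r by nra.
(* The choice r^2 = 3 matches the G2 and H2 terms of 2 L; the cross terms compare because r <= 2 and
   D <= 0. *)
have L1 : (r * A + B) ^+ 2 <= 2 * L * M.
  apply: le_trans CS _; rewrite ler_wpM2r // LE.
  have : 0 <= (2 - r) * - D by rewrite mulr_ge0 ?oppr_ge0 ?subr_ge0.
  nra.
suff : 2 * ((3 * A + 2 * p / (p + 1) * B) * E + (p - 1) ^+ 2 / (2 * (p + 1) ^+ 2) * B ^+ 2)
    <= (r * A + B) ^+ 2 by lra.
rewrite -subr_ge0.
(* The B^2 terms cancel, since 1 - 4p/(p+1)^2 = (p-1)^2/(p+1)^2, and r^2 = 3 removes two more; what
   remains has the sign of p - r. *)
have -> : (r * A + B) ^+ 2 - 2 * ((3 * A + 2 * p / (p + 1) * B) * E +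
    (p - 1) ^+ 2 / (2 * (p + 1) ^+ 2) * B ^+ 2) =
    (r ^+ 2 - 3) * A ^+ 2 + (r ^+ 2 - 3) * (2 * A * B / (p + 1)) +
    2 * ((r - 1) * (p - r)) * (A * B) / (p + 1).
  by rewrite EE; field.
rewrite r2 !subrr !mul0r !add0r mulr_ge0 ?invr_ge0 ?addr_ge0 ?(ltW p0) //.
by rewrite !mulr_ge0 // ?subr_ge0.
Qed.

Lemma mass_center_bound y K : integ (fun x => (x - y) ^+ 2 * u x ^+ 2) <= K ->
  (X - y * M) ^+ 2 <= K * M.
Proof.
move=> HK; apply: (@le_trans _ _ (integ (fun x => (x - y) ^+ 2 * u x ^+ 2) * M)); last first.
  by rewrite ler_wpM2r.
have -> : X - y * M = integ (fun x => ((x - y) * u x) * u x).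
  rewrite (@eq_integ _ _ (fun x => x * (u x * u x) - y * (u x * u x))); last by move=> x; ring.
  by rewrite integB ?integZ; [ |prove_rapid..].
have -> : M = integ (fun x => u x ^+ 2) by apply: eq_integ => x; rewrite expr2.
rewrite (@eq_integ _ (fun x => (x - y) ^+ 2 * u x ^+ 2) (fun x => ((x - y) * u x) ^+ 2)); last by move=> x; rewrite exprMn.
by apply: integ_Cauchy_Schwarz; prove_rapid.
Qed.

(** Integrating by parts moves the derivatives off one factor u, so the weight x - y falls on u
    alone, whose second moment is controlled. The other factor [w] has its squared norm bounded by
    L. *)
Lemma energy_center_bound y K : integ (fun x => (x - y) ^+ 2 * u x ^+ 2) <= K ->
  (Y - y * E) ^+ 2 <= K * L.
Proof.
move=> HK.
pose w x := (p + 1)^-1 * h x - 2^-1 * u2 x.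
have rw : rapid w by rewrite /w; prove_rapid.
have wL : integ (fun x => w x ^+ 2) <= L.
  rewrite (@eq_integ _ _ (fun x => (p + 1)^-1 ^+ 2 * (h x * h x) - (p + 1)^-1 * (u2 x * h x) + 4^-1 * (u2 x * u2 x)));
    last by move=> x; rewrite /w; field.
  rewrite integD ?integB ?integZ -?/G2 -?/D -?/H2 ?LE; [ |prove_rapid..].
  have a0 : 0 <= (p + 1)^-1 by rewrite invr_ge0 ltW.
  have a1 : (p + 1)^-1 <= 2^-1 by rewrite lef_pV2 ?posrE // -[2]/(1 + 1) lerD2r ltW.
  move: a0 a1; set a := (p + 1)^-1 => a0 a1.
  have aa : a ^+ 2 <= 2^-1 * 2^-1 by rewrite expr2; apply: ler_pM.
  have h0 : 0 <= (2^-1 - a ^+ 2) * H2 by rewrite mulr_ge0 //; lra.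
  have d0 : 0 <= (2 - a) * - D by rewrite mulr_ge0 ?oppr_ge0 //; lra.
  rewrite -subr_ge0.
  have -> : 3 / 2 * G2 - 2 * D + 2^-1 * H2 - (a ^+ 2 * H2 - a * D + 4^-1 * G2) =
    (2^-1 - a ^+ 2) * H2 + (2 - a) * - D + 5 / 4 * G2 by field.
  by rewrite !addr_ge0 // mulr_ge0 // divr_ge0.
apply: (@le_trans _ _ (integ (fun x => (x - y) ^+ 2 * u x ^+ 2) * L)); last first.
  by rewrite ler_wpM2r // (le_trans _ wL) // integ_ge0 // => x; exact: sqr_ge0.
apply: (@le_trans _ _ (integ (fun x => (x - y) ^+ 2 * u x ^+ 2) * integ (fun x => w x ^+ 2))); last first.
  by rewrite ler_wpM2l // integ_ge0 // => x; rewrite -exprMn sqr_ge0.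
have -> : Y - y * E = integ (fun x => ((x - y) * u x) * w x).
  rewrite /energy_moment /energy -integZ -?integB; [ |prove_rapid..].
  apply: (@integ_eq_deriv _ _ _ (fun x => 2^-1 * ((x - y) * (u x * u1 x)) - 4^-1 * (u x * u x))); [|prove_rapid..].
  eapply has_deriv_eq; first by prove_has_deriv.
  by move=> x /=; rewrite /w FE; field.
rewrite (@eq_integ _ (fun x => (x - y) ^+ 2 * u x ^+ 2) (fun x => ((x - y) * u x) ^+ 2)); last by move=> x; rewrite exprMn.
by apply: integ_Cauchy_Schwarz; prove_rapid.
Qed.

End FluxIdentities.

(** * Lower bounds on integrals, and finite-time blow-up *)

Section Bounds.
Set Implicit Arguments.
Unset Strict Implicit.
Context (R : realType).
Implicit Types f g u : R -> R.

Notation mu := (@lebesgue_measure R).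

Lemma Rintegral_indic_itv (a b : R) : a < b -> \int[mu]_x \1_(`[a, b]) x = b - a.
Proof.
move=> ab; rewrite /Rintegral integral_indic // setIT.
by rewrite /= lebesgue_measure_itv /= lte_fin ab.
Qed.

(** Indicators are not continuous, hence not [rapid], and need their own comparison. *)
Lemma integ_ge_indic f c (a b : R) : rapid f -> a < b ->
  (forall x, c * \1_(`[a, b]) x <= f x) -> c * (b - a) <= integ f.
Proof.
move=> rf ab H; rewrite -(Rintegral_indic_itv ab) -RintegralZl //; last first.
  exact: integrable_indic_itv.
apply: le_Rintegral => //; last exact: rapid_integrable.
exact: (integrableZl measurableT c (integrable_indic_itv a b true false)).
Qed.

Lemma integ_le_indic f g c (a b : R) : rapid f -> rapid g -> a < b ->
  (forall x, f x <= g x + c * \1_(`[a, b]) x) -> integ f <= integ g + c * (b - a).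
Proof.
move=> rf rg ab H; rewrite -lerBlDl -integB // -[leLHS]opprK.
have rN : rapid (fun x => g x - f x) by exact: rapidB.
suff : - c * (b - a) <= integ (fun x => g x - f x).
  by rewrite !integB // mulNr; lra.
apply: integ_ge_indic => // x.
by rewrite mulNr; have := H x; lra.
Qed.

Lemma integ_gt0 f (a : R) : rapid f -> (forall x, 0 <= f x) -> 0 < f a -> 0 < integ f.
Proof.
move=> rf f0 fa.
have fa2 : 0 < f a / 2 by rewrite divr_gt0.
have /cvgrPdist_lt /(_ _ fa2) := rf.1 a.
move=> /nbhs_ballP[e /= e0 H].
have e2 : 0 < e / 2 by rewrite divr_gt0.
have ab : a - e / 2 < a + e / 2 by lra.
apply: lt_le_trans (@integ_ge_indic f (f a / 2) _ _ rf ab _).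
  by rewrite mulr_gt0 // subr_gt0.
move=> x; rewrite indicE; case: (boolP (x \in _)) => [|_]; last by rewrite mulr0.
rewrite mulr1 inE /= in_itv /= => /andP[x1 x2].
have : `|f a - f x| < f a / 2.
  by apply: H; rewrite /ball /= ltr_norml; apply/andP; split; lra.
by rewrite ltr_norml => /andP[? ?]; lra.
Qed.

(** The mass splits into three parts: |x - y| > r carries at most m/4 by the second moment, the
    points within r where u^2 <= d carry at most m/4, and elsewhere u^2 <= h u/c. The bound is
    uniform in u and in the center y. *)
Lemma potential_lower_bound (q K m : R) : 0 < q -> 0 <= K -> 0 < m ->
  exists2 b, 0 < b & forall u h y, rapid u -> rapid h ->
    (forall x, h x = `|u x| `^ q * u x) ->
    integ (fun x => (x - y) ^+ 2 * u x ^+ 2) <= K -> mass u = m ->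
    b <= potential u h.
Proof.
move=> q0 K0 m0.
(* Chosen so that K/r^2 <= m/4, with K + 1 to keep r positive; below, 2 r d = m/4, and c is the
   value of |u|^q where u^2 = d. *)
pose r2 := 4 * (K + 1) / m; pose r := Num.sqrt r2.
have r20 : 0 < r2 by rewrite divr_gt0 // mulr_gt0 // ltr_wpDl.
have r0 : 0 < r by rewrite sqrtr_gt0.
pose d := m / (8 * r).
have d0 : 0 < d by rewrite divr_gt0 // mulr_gt0.
pose c := Num.sqrt d `^ q.
have c0 : 0 < c by rewrite powR_gt0 // sqrtr_gt0.
exists (m / 2 * c); first by rewrite mulr_gt0 // divr_gt0.
move=> u h y ru rh hE HK um.
have yr : y - r < y + r by lra.
have ruu : rapid (fun x => (x - y) ^+ 2 * u x ^+ 2).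
  apply: (@eq_rapid _ (fun x => ((x - y) * u x) * ((x - y) * u x))); first by prove_rapid.
  by move=> x; ring.
have : mass u <= integ (fun x => r2^-1 * ((x - y) ^+ 2 * u x ^+ 2) + c^-1 * (h x * u x))
    + d * (y + r - (y - r)).
  apply: integ_le_indic => // [||x].
  - by prove_rapid.
  - by apply: rapidD; apply: rapidZ => //; exact: rapidM.
  - have P0 : 0 <= c^-1 * (h x * u x).
      rewrite hE -mulrA -expr2; apply: mulr_ge0; first by rewrite invr_ge0 ltW.
      by apply: mulr_ge0; [exact: powR_ge0|exact: sqr_ge0].
    have Q0 : 0 <= r2^-1 * ((x - y) ^+ 2 * u x ^+ 2).
      by apply: mulr_ge0; [rewrite invr_ge0 ltW|rewrite -exprMn sqr_ge0].
    rewrite -[u x * u x]expr2 indicE; case: (boolP (x \in _)) => [_|]; last first.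
      rewrite mulr0 addr0 notin_setE /= in_itv /= => xr.
      apply: (@le_trans _ _ (r2^-1 * ((x - y) ^+ 2 * u x ^+ 2))); last by rewrite lerDl.
      rewrite mulrA ler_peMl ?sqr_ge0 // mulrC ler_pdivlMr // mul1r.
      rewrite -[r2]sqr_sqrtr ?(ltW r20) // -/r -[(x - y) ^+ 2]real_normK ?num_real //.
      rewrite ler_pXn2r ?nnegrE ?(ltW r0) //.
      have [//|xr'] := leP r `|x - y|.
      move: xr'; rewrite ltr_norml => /andP[? ?]; case: xr; apply/andP; split; lra.
    rewrite mulr1; have [ud|ud] := leP (u x ^+ 2) d; first by lra.
    suff : u x ^+ 2 <= c^-1 * (h x * u x) by lra.
    rewrite mulrC ler_pdivlMr // hE mulrC -mulrA -expr2 ler_wpM2r ?sqr_ge0 //.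
    rewrite ge0_ler_powR ?nnegrE ?sqrtr_ge0 ?(ltW q0) //.
    by rewrite -sqrtr_sqr; apply: ler_wsqrtr; exact: ltW.
have rhu : rapid (fun x => h x * u x) by prove_rapid.
rewrite integD ?integZ //; [|exact: rapidZ..].
rewrite um -/(potential u h) => H.
have H1 : r2^-1 * integ (fun x => (x - y) ^+ 2 * u x ^+ 2) <= m / 4.
  rewrite mulrC ler_pdivrMr //.
  apply: le_trans HK _; rewrite /r2.
  have -> : m / 4 * (4 * (K + 1) / m) = K + 1 by field; rewrite gt_eqF.
  by rewrite lerDl.
have H2 : d * (y + r - (y - r)) = m / 4 by rewrite /d; field; rewrite gt_eqF.
have H3 : m / 2 <= c^-1 * potential u h by move: H; rewrite H2; lra.
by move: H3; rewrite [leRHS]mulrC ler_pdivlMr.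
Qed.

(** The derivative of atan g is at least 1/c, so atan g grows by at least pi on [0, c pi], whereas
    its values lie in an open interval of length pi. *)
Lemma riccati_blowup (g dg : R -> R) (c : R) : has_deriv g dg -> 0 < c ->
  (forall t, 1 + g t ^+ 2 <= c * dg t) -> False.
Proof.
move=> Hg c0 H.
have Ha : has_deriv (fun t => atan (g t)) (fun t => (1 + g t ^+ 2)^-1 * dg t).
  apply: (@has_deriv_comp _ g (@atan R) dg (fun z => (1 + z ^+ 2)^-1)) => // t.
  exact: is_derive1_atan.
have T0 : 0 < c * pi by rewrite mulr_gt0 // pi_gt0.
have ca := has_deriv_continuous Ha.
have [x _ e] := MVT T0 (fun x _ => Ha x) (continuous_subspaceT ca).
have : c^-1 <= (1 + g x ^+ 2)^-1 * dg x.
  rewrite mulrC ler_pdivlMr; last by rewrite ltr_pwDl ?sqr_ge0.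
  by rewrite mulrC ler_pdivrMr // mulrC.
move=> /(ler_wpM2r (ltW T0)); rewrite subr0 in e; rewrite -e mulKf ?gt_eqF //.
have := atan_ltpi2 (g (c * pi)); have := atan_gtNpi2 (g 0).
lra.
Qed.

End Bounds.

(** * Schwartz solutions *)

Section Schwartz.
Set Implicit Arguments.
Unset Strict Implicit.
Context (R : realType).
Implicit Types f g w : R -> R.

Lemma smooth_has_deriv f n : smooth f -> has_deriv (derive1n n f) (derive1n n.+1 f).
Proof.
move=> sf x; rewrite [derive1n n.+1 f x]derive1E; apply: derivableP.
exact: sf.
Qed.

Lemma has_deriv_derive1 f df : has_deriv f df -> derive1 f = df.
Proof.
move=> H; apply/funext => x; rewrite derive1E.
exact: (@derive_val _ _ _ _ _ _ _ (H x)).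
Qed.

Lemma schwartz_rapid f n : schwartz f -> rapid (derive1n n f).
Proof.
move=> [sf bf]; split; first exact: has_deriv_continuous (smooth_has_deriv n sf).
have bS k x : ((`|x ^+ k * derive1n n f x|)%:E <= schwartz_seminorm k n f)%E.
  by apply: ereal_sup_ubound; exists x.
move=> k; move: (bf k n) (bS k).
(* The value -oo is excluded because the supremum dominates the value at 0. *)
case: (schwartz_seminorm k n f) => [r| |] // _ {}bS; last by have := bS 0.
exists r => x; have := bS x; rewrite lee_fin normrM normrX //.
Qed.

Lemma derive1n_diff_quotient f g w c n : smooth f -> smooth g -> smooth w ->
  derive1n n (fun x => c * (f x - g x) - w x) =
  (fun x => c * (derive1n n f x - derive1n n g x) - derive1n n w x).
Proof.
move=> sf sg sw; elim: n => [//|n IH]; rewrite derive1nS IH.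
apply: has_deriv_derive1; apply: has_derivB; last exact: smooth_has_deriv.
by apply: has_derivZ; apply: has_derivB; exact: smooth_has_deriv.
Qed.

(** The seminorm of index (k, n) is the |x|^k-weighted sup norm of the n-th derivative, and
    [derive1n] commutes with the difference quotient. *)
Lemma schwartz_curve_deriv (u : R -> R -> R) t w n :
  (forall s, schwartz (u s)) -> schwartz w ->
  schwartz_cvg (0^' : set_system R) (fun h x => h^-1 * (u (t + h) x - u t x)) w ->
  curve_deriv (fun s => derive1n n (u s)) t (derive1n n w).
Proof.
move=> su sw H k e e0.
have := H k n; move=> /(_ [set y | (y < e%:E)%E]) /=.
have N : nbhs (0%E : \bar R) [set y : \bar R | (y < e%:E)%E].
  by apply: (@open_ereal_lt' R 0%E e%:E); rewrite lte_fin.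
move=> /(_ N) {}H; near=> h => x.
have Hh : (schwartz_seminorm k n (fun x => h^-1 * (u (t + h) x - u t x) - w x)%R < e%:E)%E.
  by near: h.
rewrite -normrX -normrM -lee_fin; apply: le_trans (ltW Hh).
apply: ereal_sup_ubound; exists x => //.
by rewrite derive1n_diff_quotient //; [case: (su (t + h))|case: (su t)|case: sw].
Unshelve. all: by end_near. Qed.

End Schwartz.

(** * Time derivatives of the functionals along a solution, and the contradiction *)

Section Solution.
Set Implicit Arguments.
Unset Strict Implicit.
Context (R : realType) (p : R) (p1 : 1 < p).
Context (u v : R -> R -> R).
Hypotheses (su : forall t, schwartz (u t)) (sv : forall t, schwartz (v t)).
Hypothesis uv : forall t, schwartz_cvg (0^' : set_system R)
  (fun h x => h^-1 * (u (t + h) x - u t x)) (v t).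
Hypothesis gKdV : defocusing_gKdV p u.

Let q0 : 0 < p - 1. Proof. by rewrite subr_gt0. Qed.

Let h t x := fpw (p - 1) (u t x).
Let F t x := Fpw (p - 1) (u t x).

Lemma solution_slice t : gKdV_slice p (u t) (derive1n 1 (u t)) (derive1n 2 (u t))
  (derive1n 3 (u t)) (v t) (derive1n 1 (v t)) (fun x => pw (p - 1) (u t x))
  (h t) (fun x => p * (pw (p - 1) (u t x) * derive1n 1 (u t) x)) (F t).
Proof.
have du n : has_deriv (derive1n n (u t)) (derive1n n.+1 (u t)).
  by apply: smooth_has_deriv; case: (su t).
have ru n : rapid (derive1n n (u t)) by exact: schwartz_rapid.
have cP : continuous (fun x => pw (p - 1) (u t x)).
  move=> x; apply: continuous_comp; first exact: (has_deriv_continuous (du 0%N)).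
  exact: pw_continuous.
have bP : exists C, forall x, `|pw (p - 1) (u t x)| <= C.
  have [C HC] := rapid_bdd (ru 0%N); exists (C `^ (p - 1)) => x.
  by rewrite ger0_norm ?pw_ge0 //; exact: (le_pw q0 (HC x)).
have dh : has_deriv (h t) (fun x => p * (pw (p - 1) (u t x) * derive1n 1 (u t) x)).
  apply: has_deriv_eq; first exact: (has_deriv_comp (du 0%N) (has_deriv_fpw q0)).
  by move=> x /=; rewrite subrK mulrA.
have rh : rapid (h t) by exact: (rapid_bddM cP bP (ru 0%N)).
have pE : p - 1 + 2 = p + 1 by ring.
have FE x : F t x = (p + 1)^-1 * (h t x * u t x) by rewrite /F /Fpw pE.
have ru0 : rapid (u t) by exact: (ru 0%N).
have dv0 : has_deriv (v t) (derive1n 1 (v t)).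
  by apply: (smooth_has_deriv 0); case: (sv t).
have rF : rapid (F t).
  by apply: (@eq_rapid _ (fun x => (p + 1)^-1 * (h t x * u t x))) => //; prove_rapid.
apply: (GKdVSlice (du 0%N) (du 1%N) (du 2%N) dv0 dh
  (has_deriv_comp (du 0%N) (has_deriv_Fpw q0)) ru0 (ru 1%N) (ru 2%N) (ru 3%N)
  (schwartz_rapid 0 (sv t)) (schwartz_rapid 1 (sv t)) rh
  (rapidZ _ (rapid_bddM cP bP (ru 1%N))) rF) => //.
- by move=> x; exact: pw_ge0.
- move=> x; have := gKdV t x.
  rewrite (has_deriv_derive1 dh).
  (* The Schwartz-space derivative is also the pointwise one, by the seminorm k = n = 0. *)
  suff -> : derive1 (fun s => u s x) t = v t x by move=> <-; rewrite addrC addrK.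
  rewrite derive1E; apply: (@derive_val _ _ _ _ _ _ _ _).
  apply: is_derive_cvg; apply/cvgrPdist_le => e e0.
  have H := @schwartz_curve_deriv _ u t (v t) 0%N su (sv t) (uv t) 0%N e e0.
  near=> k; rewrite distrC.
  have H1 : forall x, `|x| ^+ 0 * `|k^-1 * (u (t + k) x - u t x) - v t x| <= e by near: k.
  by have := H1 x; rewrite mul1r.
Unshelve. all: by end_near. Qed.

Let sq_taylor (C : R) : exists D, 0 <= D /\ forall a b : R, `|a| <= C -> `|b| <= C ->
  `|b * b - a * a - 2 * a * (b - a)| <= D * (b - a) ^+ 2.
Proof.
exists 1; split => // a b _ _.
by rewrite (_ : _ - _ = (b - a) ^+ 2) ?mul1r ?ger0_norm ?sqr_ge0 //; ring.
Qed.

Let dbl_bdd (C : R) : exists D, 0 <= D /\ forall a : R, `|a| <= C -> `|2 * a| <= D.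
Proof.
exists (2 * `|C|); split; first by rewrite mulr_ge0.
by move=> a aC; rewrite normrM ger0_norm // ler_wpM2l // (le_trans aC) // ler_norm.
Qed.

Let sq_curve n t : curve_deriv
  (fun s x => derive1n n (u s) x * derive1n n (u s) x) t
  (fun x => 2 * (derive1n n (u t) x * derive1n n (v t) x)).
Proof.
have H := @schwartz_curve_deriv _ u t (v t) n su (sv t) (uv t).
have := @curve_deriv_comp _ (fun s => s * s) (fun s => 2 * s) _ t _ sq_taylor dbl_bdd
  (schwartz_rapid n (su t)) (schwartz_rapid n (sv t)) H.
by congr (curve_deriv _ _ _); apply/funext => x; rewrite mulrA.
Qed.

(** [Fpw] is twice differentiable with second derivative p |s|^(p-1), bounded on bounded sets, so
    [taylor2] supplies the remainder that the chain rule asks for. *)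
Let energy_curve t : curve_deriv
  (fun s x => 2^-1 * (derive1n 1 (u s) x * derive1n 1 (u s) x) + F s x) t
  (fun x => derive1n 1 (u t) x * derive1n 1 (v t) x + h t x * v t x).
Proof.
have H := @schwartz_curve_deriv _ u t (v t) 0 su (sv t) (uv t).
have FT C : exists D, 0 <= D /\ forall a b, `|a| <= C -> `|b| <= C ->
    `|Fpw (p - 1) b - Fpw (p - 1) a - fpw (p - 1) a * (b - a)| <= D * (b - a) ^+ 2.
  exists ((p - 1 + 1) * C `^ (p - 1)); split.
    by rewrite mulr_ge0 ?powR_ge0 // addr_ge0 // ltW.
  apply: (taylor2 (has_deriv_Fpw q0) (has_deriv_fpw q0)) => a aC.
  rewrite ger0_norm; last by rewrite mulr_ge0 ?pw_ge0 // addr_ge0 // ltW.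
  by rewrite ler_wpM2l ?(le_pw q0 aC) // addr_ge0 // ltW.
have fB C : exists D, 0 <= D /\ forall a, `|a| <= C -> `|fpw (p - 1) a| <= D.
  exists (C `^ (p - 1) * `|C|); split; first by rewrite mulr_ge0 ?powR_ge0.
  move=> a aC; rewrite normrM ger0_norm ?pw_ge0 //; apply: ler_pM => //.
  - exact: pw_ge0.
  - exact: (le_pw q0 aC).
  - by rewrite (le_trans aC) // ler_norm.
have HF := @curve_deriv_comp _ (Fpw (p - 1)) (fpw (p - 1)) _ t _ FT fB
  (schwartz_rapid 0 (su t)) (schwartz_rapid 0 (sv t)) H.
have := curve_derivD (curve_derivZ 2^-1 (@sq_curve 1 t)) HF.
by congr (curve_deriv _ _ _); apply/funext => x; rewrite mulKf.
Qed.

Lemma mass_deriv : has_deriv (fun t => mass (u t)) (fun=> 0).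
Proof.
move=> t; rewrite -(mass_flux (solution_slice t)).
apply: integ_time_deriv (@sq_curve 0 t) => [s|].
  have := slice_ru (solution_slice s) => ?; prove_rapid.
have := slice_ru (solution_slice t); have := slice_rv (solution_slice t) => ? ?; prove_rapid.
Qed.

Lemma mass_moment_deriv : has_deriv (fun t => mass_moment (u t))
  (fun t => - mass_current p (u t) (derive1n 1 (u t)) (h t)).
Proof.
move=> t; rewrite -(mass_moment_flux p1 (solution_slice t)).
apply: integ_time_deriv (curve_derivX (@sq_curve 0 t)) => [s|].
  have := slice_ru (solution_slice s) => ?; prove_rapid.
have := slice_ru (solution_slice t); have := slice_rv (solution_slice t) => ? ?; prove_rapid.
Qed.

Let re s : rapid (fun x => 2^-1 * (derive1n 1 (u s) x * derive1n 1 (u s) x) + F s x).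
Proof.
have := slice_ru1 (solution_slice s); have := slice_rF (solution_slice s) => ? ?; prove_rapid.
Qed.

Let rde t : rapid (fun x => derive1n 1 (u t) x * derive1n 1 (v t) x + h t x * v t x).
Proof.
have := slice_ru1 (solution_slice t); have := slice_rv1 (solution_slice t) => ? ?.
have := slice_rv (solution_slice t); have := slice_rh (solution_slice t) => ? ?.
prove_rapid.
Qed.

Lemma energy_deriv : has_deriv (fun t => energy (derive1n 1 (u t)) (F t)) (fun=> 0).
Proof.
move=> t; rewrite -(energy_flux (solution_slice t)).
exact: integ_time_deriv (energy_curve t).
Qed.

Lemma energy_moment_deriv : has_deriv (fun t => energy_moment (derive1n 1 (u t)) (F t))
  (fun t => - energy_current (derive1n 2 (u t)) (h t)).
Proof.
move=> t; rewrite -(energy_moment_flux (solution_slice t)).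
apply: integ_time_deriv (curve_derivX (energy_curve t)) => [s|]; exact: rapidX.
Qed.

Lemma no_uniform_localization (xc : R -> R) K : Num.sqrt 3 <= p ->
  (exists t x, u t x != 0) ->
  (forall t, integ (fun x => (x - xc t) ^+ 2 * u t x ^+ 2) <= K) -> False.
Proof.
move=> p3 [t0 [x0 ux0]] HK.
have K0 : 0 <= K.
  by apply: le_trans (HK 0); apply: integ_ge0 => x; rewrite -exprMn sqr_ge0.
pose m := mass (u 0); pose E := energy (derive1n 1 (u 0)) (F 0).
have mt t : mass (u t) = m.
  exact: (@is_derive_0_is_cst _ (fun t => mass (u t)) t 0 mass_deriv).
have Et t : energy (derive1n 1 (u t)) (F t) = E.
  exact: (@is_derive_0_is_cst _ (fun t => energy (derive1n 1 (u t)) (F t)) t 0 energy_deriv).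
have m0 : 0 < m.
  rewrite -(mt t0); have ru := slice_ru (solution_slice t0).
  apply: (@integ_gt0 _ _ x0); first by prove_rapid.
    by move=> x; rewrite -expr2 sqr_ge0.
  by rewrite -expr2 lt_def sqr_ge0 sqrf_eq0 ux0.
(* As the mass is conserved, one b serves for all times. *)
have [b b0 Hb] := potential_lower_bound q0 K0 m0.
have bt t : b <= potential (u t) (h t).
  have S := solution_slice t; apply: (Hb _ _ (xc t)) => //.
  - exact: slice_ru S.
  - exact: slice_rh S.
have p0 : 0 < p by exact: lt_trans p1.
have pp0 : 0 < p + 1 by exact: addr_gt0.
have E0 : 0 < E.
  rewrite -(Et 0); apply: lt_le_trans (energy_ge (solution_slice 0)).
  by rewrite mulr_gt0 ?invr_gt0 // (lt_le_trans b0).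
pose X t := mass_moment (u t); pose Y t := energy_moment (derive1n 1 (u t)) (F t).
pose J t := mass_current p (u t) (derive1n 1 (u t)) (h t).
pose L t := energy_current (derive1n 2 (u t)) (h t).
pose g t := m^-1 * X t - E^-1 * Y t.
pose dg t := m^-1 * - J t - E^-1 * - L t.
have Hg : has_deriv g dg.
  by apply: has_derivB; apply: has_derivZ; [exact: mass_moment_deriv|exact: energy_moment_deriv].
(* The gain in [dispersion_ineq] with B >= b, divided by m E. *)
pose d := (p - 1) ^+ 2 / (2 * (p + 1) ^+ 2) * b ^+ 2 / (m * E).
have d0 : 0 < d.
  by rewrite /d !(divr_gt0, mulr_gt0, exprn_gt0).
have dgd t : d <= dg t.
  have := dispersion_ineq p1 (solution_slice t) p3; rewrite Et mt -/(J t) -/(L t) => H.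
  have -> : dg t = (L t * m - J t * E) / (m * E).
    by rewrite /dg; field; rewrite !gt_eqF.
  rewrite /d ler_pM2r ?invr_gt0 ?mulr_gt0 // lerBrDl; apply: le_trans H.
  rewrite lerD2l; apply: ler_wpM2l; last first.
    by rewrite ler_pXn2r ?nnegrE ?(ltW b0) // (le_trans (ltW b0)).
  by rewrite divr_ge0 ?sqr_ge0 // mulr_ge0 // sqr_ge0.
(* Bounding the mass current by the energy makes L affine in G', so that a bound in terms of L
   becomes one in terms of G'. *)
have Lt t : L t <= E * dg t + (6 + 2 * p) * E ^+ 2 / m.
  have := mass_current_le_energy p1 (solution_slice t); rewrite Et -/(J t) => H.
  have -> : L t = E * dg t + J t * (E / m).
    by rewrite /dg; field; rewrite !gt_eqF.
  rewrite lerD2l.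
  have -> : (6 + 2 * p) * E ^+ 2 / m = (6 + 2 * p) * E * (E / m) by ring.
  by rewrite ler_wpM2r // ltW // divr_gt0.
have gsq t : g t ^+ 2 <= 2 * K / m + 2 * K / E ^+ 2 * L t.
  have := mass_center_bound (solution_slice t) (HK t); rewrite mt -/(X t) => H1.
  have := energy_center_bound p1 (solution_slice t) (HK t); rewrite Et -/(Y t) -/(L t) => H2.
  (* The localization center cancels in the difference and is never differentiated. *)
  have -> : g t = m^-1 * (X t - xc t * m) - E^-1 * (Y t - xc t * E).
    by rewrite /g; field; rewrite !gt_eqF.
  set a := X t - _ in H1 *; set c := Y t - _ in H2 *.
  have : (m^-1 * a - E^-1 * c) ^+ 2 <= 2 * (m^-1 ^+ 2 * a ^+ 2) + 2 * (E^-1 ^+ 2 * c ^+ 2).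
    by have := sqr_ge0 (m^-1 * a + E^-1 * c); rewrite -!exprMn; nra.
  move=> /le_trans; apply.
  have -> : 2 * K / m = 2 * (m^-1 ^+ 2 * (K * m)) by field; rewrite gt_eqF.
  have -> : 2 * K / E ^+ 2 * L t = 2 * (E^-1 ^+ 2 * (K * L t)) by field; rewrite gt_eqF.
  by apply: lerD; rewrite ler_wpM2l // ler_wpM2l // sqr_ge0.
pose al := 2 * K / m + 2 * K / E ^+ 2 * ((6 + 2 * p) * E ^+ 2 / m).
have al0 : 0 <= al.
  by rewrite /al !(addr_ge0, mulr_ge0, divr_ge0, invr_ge0, sqr_ge0) // ltW.
have be0 : 0 <= 2 * K / E by rewrite divr_ge0 ?mulr_ge0 // ltW.
(* From 1 + G^2 <= 1 + al + (2K/E) G', the constant 1 + al is absorbed as (1 + al)/d times G', since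
   G' >= d. *)
apply: (@riccati_blowup _ g dg ((1 + al) / d + 2 * K / E) Hg).
  by rewrite ltr_wpDr // divr_gt0 // ltr_wpDr.
move=> t; have H1 := gsq t.
have : 2 * K / E ^+ 2 * L t <= 2 * K / E * dg t + 2 * K / E ^+ 2 * ((6 + 2 * p) * E ^+ 2 / m).
  have -> : 2 * K / E * dg t = 2 * K / E ^+ 2 * (E * dg t) by field; rewrite gt_eqF.
  by rewrite -mulrDr ler_wpM2l // divr_ge0 ?mulr_ge0 // ?(ltW E0).
have : 1 + al <= (1 + al) / d * dg t.
  rewrite mulrAC -mulrA; apply: ler_peMr; first exact: addr_ge0.
  by rewrite ler_pdivlMr // mul1r.
rewrite mulrDl /al; lra.
Qed.

End Solution.

Theorem theorem2 (R : realType) (p : R) (hp : Num.sqrt 3 <= p)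
    (u : R -> R -> R) (hu : global_schwartz_solution p u)
    (hu0 : exists t x : R, u t x != 0) (xc : R -> R) :
  ereal_sup (range (fun t : R =>
    (\int[lebesgue_measure]_(x in [set: R])
       ((x - xc t) ^+ 2 * u t x ^+ 2)%:E)%E)) = (+oo)%E.
Proof.
have p1 : 1 < p.
  by apply: lt_le_trans hp; rewrite -[ltLHS]sqrtr1 ltr_sqrt // ltr1n.
case: hu => -[su [v [sv uv _]]] gKdV.
set S := ereal_sup _.
have rt t : rapid (fun x => (x - xc t) ^+ 2 * u t x ^+ 2).
  have ru : rapid (u t) := schwartz_rapid 0 (su t).
  apply: (@eq_rapid _ (fun x => ((x - xc t) * u t x) * ((x - xc t) * u t x))).
    by prove_rapid.
  by move=> x; ring.
have St t : ((integ (fun x => (x - xc t) ^+ 2 * u t x ^+ 2))%:E <= S)%E.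
  by rewrite -integ_EFin // /S; apply: ereal_sup_ubound; exists t.
(* A real supremum K is a uniform bound, refuted next; -oo fails since each integral is a real
   number below S. *)
case: S St => [K| |] // St; last by have := St 0.
exfalso; apply: (no_uniform_localization p1 su sv uv gKdV (xc := xc) (K := K) hp hu0) => t.
by have := St t; rewrite lee_fin.
Qed.
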